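(* Let $n$ be a positive integer, and let $\boldsymbol{r}, \boldsymbol{c} \in \mathbb{R}_{>0}^n$ be vectors with $\sum_{i=1}^n r_i = \sum_{i=1}^n c_i = n$ and with $\boldsymbol{r} \neq \boldsymbol{1}$ and $\boldsymbol{c} \neq \boldsymbol{1}$. Then the rank-one matrix $\frac{1}{n} \boldsymbol{r} \boldsymbol{c}^\top$ does not minimize the permanent over the set of $n \times n$ matrices with non-negative real entries, row sums $\boldsymbol{r}$ and column sums $\boldsymbol{c}$.
   Context: $\boldsymbol{1}$ is the all-ones vector in $\mathbb{R}^n$. The permanent of an $n \times n$ matrix $M = (m_{ij})$ is $\operatorname{per}(M) = \sum_{\sigma \in S_n} \prod_{i=1}^n m_{i,\sigma(i)}$. A matrix $M$ has row sums $\boldsymbol{r}$ and column sums $\boldsymbol{c}$ if $M\boldsymbol{1} = \boldsymbol{r}$ and $M^\top \boldsymbol{1} = \boldsymbol{c}$. *)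

(* Defs.v *)
From HB Require Import structures.
From mathcomp Require Import all_boot all_order all_algebra.
From mathcomp Require Import perm classical_sets reals.

Set Implicit Arguments.
Unset Strict Implicit.
Unset Printing Implicit Defensive.

Import Order.TTheory GRing.Theory Num.Theory.

Local Open Scope ring_scope.
Local Open Scope classical_set_scope.

Definition permanent (R : comNzRingType) (n : nat) (M : 'M[R]_n) : R :=
  \sum_(s : 'S_n) \prod_(i < n) M i (s i).

Definition ones (R : nzRingType) (n : nat) : 'cV[R]_n := const_mx 1.

Definition nonneg_with_margins (R : realType) (n : nat) (r c : 'cV[R]_n) :
    set 'M[R]_n :=
  [set M : 'M[R]_n | [/\ (forall i j, 0 <= M i j),
                            M *m ones R n = r & M^T *m ones R n = c]].

Definition minimizes_on (R : realType) (T : Type) (f : T -> R) (A : set T)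
    (x : T) : Prop :=
  A x /\ forall y, A y -> f x <= f y.

(* Main.v *)
Require Import Defs.
From HB Require Import structures.
From mathcomp Require Import all_boot all_order all_algebra.
From mathcomp Require Import perm classical_sets reals.
From mathcomp Require Import ring lra.

Set Implicit Arguments.
Unset Strict Implicit.
Unset Printing Implicit Defensive.

Import Order.TTheory GRing.Theory Num.Theory.

Local Open Scope ring_scope.

(** The rank-one matrix [n^-1 r c^T] has positive entries, so it can be moved
    a little along any direction with zero row and column sums; it suffices to
    find one such direction along which the permanent has a nonzero first
    derivative.  The direction [(1 - r) (1 - c)^T] works: its margins vanish
    because the entries of [r] and of [c] sum to [n].

    Write [a i = (1 - r i) / r i] and [b j = (1 - c j) / c j].  Then
    [r i * c j + t * (1 - r i) * (1 - c j) = r i * c j * (1 + t * a i * b j)],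
    and the permanent is homogeneous under scaling of rows and columns
    ([permanent_scale]).  So, up to a positive constant, the permanent along
    the line is that of the matrix [1 + t * a i * b j], whose derivative at
    [t = 0] is [(n-1)! * (\sum_i a i) * (\sum_j b j)] ([permanent_1Drank1]).
    Since [\sum_i r i = n], the first sum is [\sum_i (1 - r i)^2 / r i], which
    is positive unless [r] is the all-ones vector, and likewise for [c]
    ([sum_relative_defect_gt0]).  The derivative is thus positive, and a small
    negative [t] decreases the permanent while keeping all entries
    nonnegative. *)

(** Row scalings pull out of each term directly; column scalings do so because
    each permutation meets each column once. *)
Lemma permanent_scale (R : comNzRingType) (n : nat) (x y : 'I_n -> R)
    (A : 'M[R]_n) :
  permanent (\matrix_(i, j) (x i * y j * A i j)) =
  (\prod_i x i) * (\prod_j y j) * permanent A.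
Proof.
rewrite /permanent mulr_sumr; apply: eq_bigr => s _.
rewrite [\prod_j y j](reindex_inj (@perm_inj _ s)) -!big_split /=.
by apply: eq_bigr => i _; rewrite mxE.
Qed.

Lemma prod_1DZX (R : comNzRingType) (I : finType) (w : I -> R) :
  exists q : {poly R},
    \prod_i (1 + w i *: 'X) = 1 + (\sum_i w i) *: 'X + q * 'X^2.
Proof.
apply: (big_rec2 (fun (p : {poly R}) s =>
  exists q, p = 1 + s *: 'X + q * 'X^2)).
  by exists 0; rewrite scale0r mul0r !addr0.
move=> i p s _ [q ->]; exists ((w i * s)%:P + q + w i *: 'X * q).
by rewrite -!mul_polyC polyCM polyCD; ring.
Qed.

(** The left sum does not depend on [k], as composing with a transposition
    shows; averaging over [k] then gives its value. *)
Lemma sum_perm_eval (V : zmodType) (n : nat) (v : 'I_n -> V) (k : 'I_n) :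
  (\sum_(s : 'S_n) v (s k)) *+ n = (\sum_j v j) *+ n`!.
Proof.
have indep l : \sum_(s : 'S_n) v (s l) = \sum_(s : 'S_n) v (s k).
  rewrite (reindex_inj (mulgI (tperm k l))).
  by apply: eq_bigr => s _; rewrite permM tpermR.
transitivity (\sum_l \sum_(s : 'S_n) v (s l)).
  by rewrite (eq_bigr _ (fun l _ => indep l)) sumr_const card_ord.
rewrite exchange_big /= -(card_Sn n) -sumr_const.
by apply: eq_bigr => s _; rewrite [RHS](reindex_inj (@perm_inj _ s)).
Qed.

(** Second-order expansion at the all-ones matrix in a rank-one direction.  The
    remainder is kept as a polynomial so that it is bounded near [0]. *)
Lemma permanent_1Drank1 (R : numFieldType) (n : nat) (a b : 'I_n -> R) :
  (0 < n)%N ->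
  exists q : {poly R}, forall t,
    permanent (\matrix_(i, j) (1 + t * (a i * b j))) =
    n`!%:R + n`!%:R / n%:R * (\sum_i a i) * (\sum_j b j) * t + q.[t] * t ^+ 2.
Proof.
move=> n_gt0.
have [q Eq] : exists q : {poly R},
    \sum_(s : 'S_n) \prod_i (1 + (a i * b (s i)) *: 'X) =
    n`!%:R + (\sum_(s : 'S_n) \sum_i a i * b (s i)) *: 'X + q * 'X^2.
  rewrite -(card_Sn n) -sumr_const.
  apply: (big_rec3 (fun (p x : {poly R}) y =>
    exists q, p = x + y *: 'X + q * 'X^2)) => [|s p x y _ [q ->]].
    by exists 0; rewrite scale0r mul0r !addr0.
  have [q' ->] := prod_1DZX (fun i => a i * b (s i)).
  by exists (q' + q); rewrite -!mul_polyC polyCD; ring.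
exists q => t; have /(congr1 (horner_eval t)) := Eq.
rewrite /horner_eval !hornerE horner_sum => Et.
transitivity (\sum_(s : 'S_n) (\prod_i (1 + (a i * b (s i)) *: 'X)).[t]).
  apply: eq_bigr => s _; rewrite horner_prod; apply: eq_bigr => i _.
  by rewrite !hornerE mxE mulrC.
rewrite Et -polyC_natr hornerC; congr (_ + _ * t + _).
have -> : n`!%:R / n%:R * (\sum_i a i) * (\sum_j b j) =
    \sum_i a i * (n`!%:R / n%:R * \sum_j b j).
  by rewrite -mulr_suml mulrCA mulrA.
rewrite exchange_big; apply: eq_bigr => i _; rewrite -mulr_sumr; congr (_ * _).
have nN0 : n%:R != 0 :> R by rewrite pnatr_eq0 -lt0n.
apply: (mulIf nN0); rewrite mulr_natr sum_perm_eval -mulr_natl.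
by field.
Qed.

(** Rewriting each term as [(1 - x i)^2 / x i + (1 - x i)] makes the sum of the
    correction terms vanish. *)
Lemma sum_relative_defect_gt0 (R : realFieldType) (n : nat) (x : 'cV[R]_n) :
  (forall i, 0 < x i 0) -> \sum_i x i 0 = n%:R -> x <> ones R n ->
  0 < \sum_i (1 - x i 0) / x i 0.
Proof.
move=> x_gt0 sum_x xN1.
have term_ge0 i : 0 <= (1 - x i 0) ^+ 2 / x i 0.
  by rewrite divr_ge0 ?sqr_ge0 // ltW.
have -> : \sum_i (1 - x i 0) / x i 0 = \sum_i (1 - x i 0) ^+ 2 / x i 0.
  have sum0 : \sum_i (1 - x i 0) = 0.
    by rewrite sumrB sum_x sumr_const card_ord subrr.
  rewrite -[RHS]addr0 -[X in _ = _ + X]sum0 -big_split /=; apply: eq_bigr => i _.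
  by field; rewrite gt_eqF.
rewrite lt_def sumr_ge0 // andbT; apply/eqP => sum0; apply: xN1.
apply/matrixP => i j; rewrite ord1 mxE.
have : (1 - x i 0) ^+ 2 / x i 0 == 0.
  by apply/eqP; apply: (psumr_eq0P (fun k _ => term_ge0 k) sum0).
rewrite mulf_eq0 invr_eq0 (gt_eqF (x_gt0 i)) orbF sqrf_eq0 subr_eq0.
by move/eqP => <-.
Qed.

(** To first order a step [- t] changes the value by [- s t], and the quadratic
    remainder is bounded by a constant times [t^2]. *)
Lemma small_descent_step (R : realFieldType) (s e : R) (q : {poly R}) :
  0 < s -> 0 < e ->
  exists t, [/\ 0 < t, t <= e & s * (- t) + q.[- t] * (- t) ^+ 2 < 0].
Proof.
move=> s_gt0 e_gt0; have [C qC] := poly_disk_bound q 1.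
have C_ge0 : 0 <= C by apply: le_trans (qC 0 _); rewrite ?normr0.
have C1_gt0 : 0 < C + 1 by lra.
pose t := Num.min e (Num.min 1 (s / (C + 1))).
have t_gt0 : 0 < t by rewrite !lt_min e_gt0 ltr01 divr_gt0.
have t_lee : t <= e by rewrite ge_min lexx.
have t_le1 : t <= 1 by rewrite !ge_min lexx orbT.
have t_les : t * (C + 1) <= s by rewrite -ler_pdivlMr // !ge_min lexx !orbT.
exists t; split=> //.
have /(le_trans (ler_norm _)) q_le : `|q.[- t]| <= C.
  by apply: qC; rewrite normrN gtr0_norm.
have -> : s * (- t) + q.[- t] * (- t) ^+ 2 = t * (q.[- t] * t - s) by ring.
by rewrite pmulr_rlt0 //; nra.
Qed.

(** Along this line the row sums stay constant because the entries of
    [ones R n - y] sum to zero; the column sums follow by transposition. *)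
Lemma rank1_line_mul_ones (R : realFieldType) (n : nat) (x y : 'cV[R]_n)
    (t : R) :
  (0 < n)%N -> \sum_i y i 0 = n%:R ->
  (n%:R^-1 *: (x *m y^T + t *: ((ones R n - x) *m (ones R n - y)^T)))
    *m ones R n = x.
Proof.
move=> n_gt0 sum_y.
have nN0 : n%:R != 0 :> R by rewrite pnatr_eq0 -lt0n.
have yT1 : y^T *m ones R n = n%:R%:M.
  apply/matrixP => i j; rewrite !ord1 !mxE -sum_y.
  by apply: eq_bigr => k _; rewrite !mxE mulr1.
have oneT1 : (ones R n)^T *m ones R n = n%:R%:M.
  apply/matrixP => i j; rewrite !ord1 !mxE /=.
  under eq_bigr => k _ do rewrite !mxE mulr1.
  by rewrite sumr_const card_ord.
have yC1 : (ones R n - y)^T *m ones R n = 0.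
  by rewrite linearB /= mulmxBl yT1 oneT1 subrr.
rewrite -scalemxAl mulmxDl -scalemxAl -!mulmxA yT1 yC1 mulmx0 scaler0 addr0.
by rewrite mul_mx_scalar scalerA mulVf ?scale1r.
Qed.

Theorem proposition1p5 (R : realType) (n : nat) (r c : 'cV[R]_n)
    (n_gt0 : (0 < n)%N)
    (r_gt0 : forall i, 0 < r i 0) (c_gt0 : forall i, 0 < c i 0)
    (sum_r : \sum_(i < n) r i 0 = n%:R) (sum_c : \sum_(i < n) c i 0 = n%:R)
    (r_neq1 : r <> ones R n) (c_neq1 : c <> ones R n) :
  ~ minimizes_on (@permanent R n) (nonneg_with_margins r c)
      (n%:R^-1 *: (r *m c^T)).
Proof.
move=> [_ min_rc].
pose a i := (1 - r i 0) / r i 0; pose b j := (1 - c j 0) / c j 0.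
pose L t := n%:R^-1 *: (r *m c^T + t *: ((ones R n - r) *m (ones R n - c)^T)).
have nV_gt0 : 0 < n%:R^-1 :> R by rewrite invr_gt0 ltr0n.
have LE t : L t = \matrix_(i, j) ((n%:R^-1 * r i 0) * c j 0 *
    (\matrix_(i, j) (1 + t * (a i * b j)) : 'M_n) i j).
  apply/matrixP => i j; rewrite !mxE !big_ord1 !mxE /a /b.
  by field; rewrite !gt_eqF ?ltr0n.
have [q perE] := permanent_1Drank1 a b n_gt0.
pose s := n`!%:R / n%:R * (\sum_i a i) * (\sum_j b j).
have s_gt0 : 0 < s.
  by rewrite !mulr_gt0 ?sum_relative_defect_gt0 // ltr0n fact_gt0.
(* Steps up to 1 / (1 + S) keep every factor 1 + t * (a i * b j) nonnegative. *)
pose S := \sum_i \sum_j `|a i * b j|.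
have ab_le i j : a i * b j <= S.
  apply: le_trans (ler_norm _) _; rewrite /S (bigD1 i) //= (bigD1 j) //=.
  by rewrite -addrA lerDl addr_ge0 // !sumr_ge0 // => k _; rewrite sumr_ge0.
have S_ge0 : 0 <= S by rewrite sumr_ge0 // => i _; rewrite sumr_ge0.
have e_gt0 : 0 < (1 + S)^-1 by rewrite invr_gt0; lra.
have [t [t_gt0 t_le descent]] := small_descent_step q s_gt0 e_gt0.
have tS_le1 : t * (1 + S) <= 1 by rewrite -ler_pdivlMr ?mul1r //; lra.
have L_margins : nonneg_with_margins r c (L (- t)).
  split=> [i j||].
  - rewrite LE !mxE; apply: mulr_ge0; first by rewrite !mulr_ge0 // ltW.
    by have := ab_le i j; nra.
  - exact: rank1_line_mul_ones.
  - rewrite linearZ linearD linearZ /= !trmx_mul !trmxK.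
    exact: rank1_line_mul_ones.
have := min_rc _ L_margins.
have -> : n%:R^-1 *: (r *m c^T) = L 0 by rewrite /L scale0r addr0.
rewrite !LE !permanent_scale ler_pM2l; last first.
  by rewrite mulr_gt0 ?prodr_gt0 // => i _; rewrite mulr_gt0.
rewrite !perE -/s mulr0 expr0n mulr0 !addr0 -addrA lerDl.
by rewrite leNgt descent.
Qed.
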